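(* Let $q\ge2$ be fixed and let $A$ be a finite set with $|A|=q$. The proportion of permutations $f$ of $A^n$ (among all $(q^n)!$ permutations of $A^n$) whose procedural complexity $\mathcal{L}(f)$ is at least $$\left\lfloor \frac{n\log q-1}{q^{-1}\log (q!)+q^{-n}\log n}\right\rfloor+1$$ tends to $1$ when $n$ tends to infinity, where $\log$ is the natural logarithm.
   Context: A transformation of $A^n$ is a map $f=(f_1,\dots,f_n):A^n\to A^n$; its coordinate function $f_i:A^n\to A$ is trivial if $f_i(x)=x_i$ for all $x$. An instruction is a transformation of $A^n$ with at most one nontrivial coordinate function. A program of length $L$ computing $f$ is a sequence of instructions $g^1,\dots,g^L$ with $f=g^L\circ\cdots\circ g^1$. The procedural complexity $\mathcal{L}(f)$ is the shortest length of a program computing $f$; the identity has procedural complexity $0$. *)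

(* Defs.v *)
From mathcomp Require Import all_boot.
From mathcomp Require Import fingroup perm.

Set Implicit Arguments.
Unset Strict Implicit.
Unset Printing Implicit Defensive.

Section Programs.

Variables (A : finType) (n : nat).
Local Notation X := {ffun 'I_n -> A}.
Implicit Types (f : X -> X) (gs : seq {ffun X -> X}).

Definition trivial_coord f (i : 'I_n) : bool := [forall x : X, f x i == x i].

Definition instruction f : bool := #|[set i | ~~ trivial_coord f i]| <= 1.

(* [run [:: g1; ...; gL] x] is [gL (... (g1 x))]: the head acts first. *)
Definition run gs (x : X) : X := foldl (fun y (g : {ffun X -> X}) => g y) x gs.

Definition computes gs f : bool :=
  all (fun g : {ffun X -> X} => instruction g) gs && [forall x, run gs x == f x].

Definition computable_in f (L : nat) : bool :=
  [exists gs : L.-tuple {ffun X -> X}, computes gs f].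

(* Every transformation is computed by some program, so that the minimum
   defining the procedural complexity is a genuine one. *)

Definition computable f : Prop := exists gs, computes gs f.

Lemma computable_ext f g : f =1 g -> computable f -> computable g.
Proof.
move=> fg [gs /andP[ins /forallP runf]]; exists gs; rewrite /computes ins /=.
by apply/forallP => x; rewrite -fg.
Qed.

Lemma computable_comp f g : computable f -> computable g -> computable (f \o g).
Proof.
move=> [fs /andP[insf /forallP runf]] [gs /andP[insg /forallP rung]].
exists (gs ++ fs); rewrite /computes all_cat insf insg /=.
apply/forallP => x; rewrite /run foldl_cat -/(run gs x) (eqP (rung x)).
exact: runf.
Qed.

Lemma computable_id : computable id.
Proof. by exists [::]; apply/forallP => x /=. Qed.

Lemma computable_coord (i : 'I_n) f :
  (forall x j, j != i -> f x j = x j) -> computable f.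
Proof.
move=> fi; exists [:: finfun f]; rewrite /computes /= andbT; apply/andP; split.
  rewrite /instruction -(cards1 i); apply/subset_leq_card/subsetP => j.
  rewrite !inE; apply: contraR => /fi fj.
  by apply/forallP => x; rewrite ffunE fj.
by apply/forallP => x; rewrite ffunE.
Qed.

Definition hamming (x y : X) : nat := #|[set i | x i != y i]|.

Definition step_to (x y : X) (i : 'I_n) : X :=
  [ffun j => if j == i then y i else x j].

Lemma step_toNe (x y : X) (i j : 'I_n) : j != i -> step_to x y i j = x j.
Proof. by move=> /negPf ji; rewrite ffunE ji. Qed.

Lemma ffun_neqP (x y : X) : x != y -> exists i, x i != y i.
Proof.
move=> xy; apply/existsP; apply: contraR xy => /existsPn xy.
by apply/eqP/ffunP => i; apply/eqP; have := xy i; rewrite negbK.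
Qed.

Lemma step_to_hamming (x y : X) (i : 'I_n) :
  x i != y i -> hamming (step_to x y i) y < hamming x y.
Proof.
move=> xyi; apply/proper_card/properP; split.
  apply/subsetP => j; rewrite !inE ffunE.
  by have [-> |//] := eqVneq j i; rewrite eqxx.
by exists i; rewrite !inE // ffunE !eqxx.
Qed.

Lemma step_to_neq (x y : X) (i : 'I_n) : x i != y i -> step_to x y i != x.
Proof.
by apply: contraNneq => /ffunP/(_ i); rewrite ffunE eqxx => ->.
Qed.

Lemma computable_tperm_step_to (x y : X) (i : 'I_n) :
  computable (tperm x (step_to x y i)).
Proof.
apply: (@computable_coord i) => z j ji.
by case: tpermP => // ->; rewrite step_toNe.
Qed.

Lemma computable_tperm (x y : X) : computable (tperm x y).
Proof.
have [m] := ubnP (hamming x y); elim: m x => // m IH x; rewrite ltnS => le_m.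
have [-> |xy] := eqVneq x y.
  by apply: computable_ext computable_id => z; rewrite tperm1 perm1.
have [i xyi] := ffun_neqP xy; have := computable_tperm_step_to x y i.
have := step_to_neq xyi; have := step_to_hamming xyi; set e := step_to x y i => de ex ce.
have [<- //|ey] := eqVneq e y.
have ct := IH e (leq_trans de le_m).
apply: computable_ext (computable_comp ce (computable_comp ct ce)) => z /=.
rewrite -!permM -[tperm x y](tpermJ_tperm ey xy) tpermC.
by rewrite conjgE tpermV mulgA.
Qed.

Lemma computable_perm (s : {perm X}) : computable s.
Proof.
have [ts -> _] := prod_tpermP s.
elim/big_rec: _ => [|t u _ cu].
  by apply: computable_ext computable_id => z; rewrite perm1.
apply: computable_ext (computable_comp cu (computable_tperm t.1 t.2)) => z.
by rewrite permM.
Qed.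

Definition collapse (c d z : X) : X := if z == c then d else z.

Lemma computable_collapse (c d : X) : computable (collapse c d).
Proof.
have [-> |cd] := eqVneq c d.
  by apply: computable_ext computable_id => z; rewrite /collapse; case: eqP.
have [i cdi] := ffun_neqP cd; pose e := step_to c d i.
have ec : e != c := step_to_neq cdi.
have ce : computable (collapse c e).
  apply: (@computable_coord i) => z j ji; rewrite /collapse.
  by case: eqP => // ->; rewrite step_toNe.
have ct := computable_tperm d e.
apply: computable_ext (computable_comp ct (computable_comp ce ct)) => z /=.
have tc : tperm d e c = c by rewrite tpermD // eq_sym.
rewrite /collapse -{1}tc (inj_eq perm_inj); case: eqP => _; first by rewrite tpermR.
by rewrite tpermK.
Qed.

Lemma computable_all f : computable f.
Proof.
have [m] := ubnP #|~: (f @: setT)|; elim: m f => // m IH f; rewrite ltnS => le_m.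
have [/injectiveP fi|/injectivePn[a [b ab fab]]] := boolP (injectiveb f).
  by apply: computable_ext (computable_perm (perm fi)) => z; rewrite permE.
have /subsetPn[c _ cf] : ~~ (setT \subset f @: setT).
  apply/negP => sub; have /eqP : f @: setT == setT by rewrite eqEsubset subsetT.
  move=> fT; have /imset_injP fi : #|f @: setT| == #|[set: X]| by rewrite fT.
  by case/eqP: ab; apply: fi; rewrite ?inE.
have cNf z : f z != c by apply: contraNneq cf => <-; apply: imset_f.
pose f' z := if z == b then c else f z.
have cf' : computable f'.
  apply: IH; apply: leq_trans le_m; apply/proper_card/properP; split.
    rewrite setCS; apply/subsetP => _ /imsetP[z _ ->].
    have [-> |zb] := eqVneq z b.
      by apply/imsetP; exists a => //; rewrite /f' (negPf ab) fab.
    by apply/imsetP; exists z => //; rewrite /f' (negPf zb).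
  exists c; rewrite inE // negbK; apply/imsetP; exists b => //.
  by rewrite /f' eqxx.
apply: computable_ext (computable_comp (computable_collapse c (f b)) cf') => z /=.
rewrite /collapse /f'; case: (eqVneq z b) => [-> |_]; first by rewrite eqxx.
by rewrite (negPf (cNf z)).
Qed.

Lemma computable_in_some f : exists L, computable_in f L.
Proof.
have [gs gsf] := computable_all f; exists (size gs).
by apply/existsP; exists (in_tuple gs).
Qed.

Definition procedural_complexity f : nat := ex_minn (computable_in_some f).

End Programs.

(* Main.v *)
(** Every instruction of a program computing a permutation is itself a
    permutation, and at most [N = n (q!)^(q^(n-1))] permutations are
    instructions. As the identity is one of them, at most [N^k] permutations
    have complexity at most [k]. The denominator of the bound is
    [ln N / q^n], so for [m = q^n] and [k] at most the quotient, [N^k] is at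
    most [(m/e)^m]. This is negligible against [m!] because
    [m! >= (m/e)^m m^(1/8)]. *)

Require Import Defs.
From mathcomp Require Import all_boot all_order all_algebra all_fingroup.
From mathcomp Require Import all_classical all_reals all_analysis.
From mathcomp Require Import ring lra.
Import Order.TTheory GRing.Theory Num.Theory numFieldNormedType.Exports.
Local Open Scope classical_set_scope.
Local Open Scope ring_scope.

(** * Counting the instructions that are permutations *)

Definition perm_instructions (A : finType) (n : nat) :
    {set {perm {ffun 'I_n -> A}}} :=
  [set s : {perm {ffun 'I_n -> A}} | instruction s]%SET.

Definition perms_at (A : finType) (n : nat) (i : 'I_n) :
    {set {perm {ffun 'I_n -> A}}} :=
  [set s : {perm {ffun 'I_n -> A}} | [forall j, (j != i) ==> trivial_coord s j]]%SET.

(** For fixed [y] and varying [a] these points form a line parallel to axis [i]. *)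
Definition ffun_insert {A : finType} {n : nat} (i : 'I_n.+1) (a : A)
    (y : {ffun 'I_n -> A}) : {ffun 'I_n.+1 -> A} :=
  [ffun j => if unlift i j is Some k then y k else a].

Lemma ffun_insertE {A : finType} {n : nat} (i : 'I_n.+1)
    (x : {ffun 'I_n.+1 -> A}) :
  ffun_insert i (x i) [ffun k => x (lift i k)] = x.
Proof.
by apply/ffunP => j; rewrite ffunE; case: unliftP => [k ->|->]; rewrite ?ffunE.
Qed.

Lemma perms_at_insert {A : finType} {n : nat} {i : 'I_n.+1}
    {s : {perm {ffun 'I_n.+1 -> A}}} (a : A) (y : {ffun 'I_n -> A}) :
  s \in perms_at A n.+1 i ->
  s (ffun_insert i a y) = ffun_insert i (s (ffun_insert i a y) i) y.
Proof.
rewrite inE => /forallP tr; apply/ffunP => j; rewrite [RHS]ffunE.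
case: unliftP => [k jk|-> //]; have := tr j; rewrite jk eq_sym neq_lift.
by move=> /forallP/(_ (ffun_insert i a y))/eqP->; rewrite ffunE liftK.
Qed.

(** A permutation changing only coordinate [i] preserves each of the [#|A| ^ n] lines parallel to
    axis [i], and is determined by the injections of [A] it induces on them. *)
Lemma card_perms_at (A : finType) (n : nat) (i : 'I_n.+1) :
  (#|perms_at A n.+1 i| <= #|A| `! ^ (#|A| ^ n))%N.
Proof.
pose code (s : {perm {ffun 'I_n.+1 -> A}}) :=
  [ffun y : {ffun 'I_n -> A} => [ffun a => s (ffun_insert i a y) i]].
have code_inj : {in perms_at A n.+1 i &, injective code}.
  move=> s t sP tP st; apply/permP => x; rewrite -(ffun_insertE i x).
  set y := [ffun k => _]; rewrite (perms_at_insert _ _ sP) (perms_at_insert _ _ tP).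
  by move/ffunP/(_ y)/ffunP/(_ (x i)): st; rewrite !ffunE => ->.
rewrite -(card_in_imset code_inj).
have <- : #|(ffun_on [set f : {ffun A -> A} | injectiveb f]%SET :
             {pred {ffun {ffun 'I_n -> A} -> {ffun A -> A}}})| =
          (#|A| `! ^ (#|A| ^ n))%N.
  by rewrite card_ffun_on card_inj_ffuns ffactnn card_ffun card_ord.
apply/subset_leq_card/fintype.subsetP => _ /imsetP[s sP ->]; apply/ffun_onP => y.
rewrite inE; apply/injectiveP => a b; rewrite !ffunE => sab.
(* Both images lie on the line of [y] and agree at [i], so they coincide. *)
have /perm_inj/ffunP/(_ i) :
    s (ffun_insert i a y) = s (ffun_insert i b y).
  by rewrite (perms_at_insert a y sP) sab -perms_at_insert.
by rewrite !ffunE unlift_none.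
Qed.

Lemma card_perm_instructions (A : finType) (n : nat) :
  (#|perm_instructions A n.+1| <= n.+1 * #|A| `! ^ (#|A| ^ n))%N.
Proof.
have sub : (perm_instructions A n.+1 \subset \bigcup_i perms_at A n.+1 i)%SET.
  apply/fintype.subsetP => s; rewrite inE /instruction => s1; apply/finset.bigcupP.
  pose N := [set i | ~~ trivial_coord s i]%SET.
  (* If every coordinate is trivial, any index will do; [ord0] exists as the dimension is [n.+1]. *)
  have [i iN|N0] := pickP (mem N); [exists i|exists ord0] => //.
    rewrite inE; apply/forallP => j; apply/implyP; apply: contraNT => js.
    have jN : j \in N by rewrite inE.
    by apply/eqP; exact: (card_le1_eqP s1).
  rewrite inE; apply/forallP => j; apply/implyP => _.
  by have := N0 j; rewrite /= inE => /negbFE.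
apply: leq_trans (subset_leq_card sub) _.
rewrite -[X in (_ <= X * _)%N]card_ord -sum_nat_const.
apply: (@big_ind2 _ _ (fun (S : {set {perm {ffun 'I_n.+1 -> A}}}) m => #|S| <= m)%N).
- by rewrite cards0.
- move=> S m T p Sm Tp.
  by apply: leq_trans (leq_add Sm Tp); exact: (leq_card_setU S T).
- by move=> i _; exact: card_perms_at.
Qed.

(** * Programs as products of permutations *)

Lemma instruction1 (A : finType) (n : nat) : (1 \in perm_instructions A n)%g.
Proof.
rewrite inE /instruction; set N := finset _.
suff -> : N = finset.set0 by rewrite cards0.
apply/finset.setP => i; rewrite !inE; apply/negbF/forallP => x; by rewrite perm1.
Qed.

Lemma card_expsg {gT : finGroupType} (B : {set gT}) (k : nat) :
  (#|B ^+ k|%g <= #|B| ^ k)%N.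
Proof.
elim: k => [|k IH]; first by rewrite expg0 cards1.
rewrite expgS expnS; apply: leq_trans (leq_mul (leqnn _) IH).
by rewrite -cardsX /mulg /= /set_mulg curry_imset2X; exact: leq_imset_card.
Qed.

(** Shorter products are padded with identity factors. *)
Lemma subset_expsg {gT : finGroupType} (B : {set gT}) (k l : nat) :
  (1 \in B)%g -> (k <= l)%N -> (B ^+ k \subset B ^+ l)%g.
Proof.
move=> B1 /subnKC <-; elim: (l - k)%N => [|d IH]; first by rewrite addn0.
by rewrite addnS expgSr; apply: fintype.subset_trans IH _; apply: mulg_subl.
Qed.

(** The composite is injective, hence so is the first instruction, which is thus a permutation;
    cancelling it leaves a permutation computed by the rest of the program. *)
Lemma run_perm_expsg (A : finType) (n : nat)
    (gs : seq {ffun {ffun 'I_n -> A} -> {ffun 'I_n -> A}})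
    (s : {perm {ffun 'I_n -> A}}) :
  computes gs s -> (s \in perm_instructions A n ^+ size gs)%g.
Proof.
rewrite /computes => /andP[].
elim: gs s => [|g gs IH] s /= => [_|/andP[insg insgs]] /forallP runs.
  rewrite expg0 inE; apply/eqP/permP => x; rewrite perm1; exact/esym/eqP/runs.
have ginj : injective g.
  by move=> x y gxy; apply: (@perm_inj _ s);
    rewrite -(eqP (runs x)) -(eqP (runs y)) /= gxy.
(* The left factor of a product of permutations acts first, like the head of a program. *)
rewrite expgS -(mulKVg (perm ginj) s); apply: mem_mulg.
  rewrite inE; move: insg; congr (_ <= 1)%N; apply: eq_card => i; rewrite !inE.
  by congr (~~ _); apply: eq_forallb => x; rewrite permE.
apply: IH => //; apply/forallP => x; rewrite permM.
by rewrite -(eqP (runs _)) /= -(permE ginj) permKV.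
Qed.

(** * Lower bound for the factorial *)

(** With [y = x / (1 + x/8)] the claim is [1 + x <= expR y]. Here [1 + x = 1 + y + x y / 8], while
    [expR y >= (1 + y/2)^2 = 1 + y + y^2 / 4]; so [x <= 2 y] is enough, and this follows from
    [x <= 1]. *)
Lemma ln1D_mul_le (R : realType) (x : R) : 0 < x -> x <= 1 ->
  ln (1 + x) * (1 + x / 8%:R) <= x.
Proof.
move=> x0 x1; have c0 : 0 < 1 + x / 8%:R by lra.
rewrite -ler_pdivlMr // -[leRHS]expRK ler_ln ?posrE ?expR_gt0 //; last by lra.
set y := x / (1 + x / 8%:R).
have yc : y * (1 + x / 8%:R) = x by rewrite /y divfK // gt_eqF.
have y0 : 0 < y by rewrite /y divr_gt0.
have -> : expR y = expR (y / 2%:R) ^+ 2 by rewrite -expRM_natl; congr expR; field.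
apply: (@le_trans _ _ ((1 + y / 2%:R) ^+ 2)); last first.
  by rewrite lerXn2r ?nnegrE ?expR_ge0 ?expR_ge1Dx //; lra.
rewrite -yc; nra.
Qed.

(* A weak Stirling bound: any positive power of [m] beyond [(m/e)^m] suffices, and
   the exponent 1/8 only needs [expR y >= (1 + y/2)^2]. *)
Lemma ln_fact_ge (R : realType) (m : nat) : (0 < m)%N ->
  m%:R * (ln (m%:R : R) - 1) + ln m%:R / 8%:R <= ln ((m `!)%:R).
Proof.
case: m => // m _; elim: m => [|m IH]; first by rewrite factS fact0 muln1 ln1; lra.
rewrite factS natrM lnM ?posrE ?ltr0n ?fact_gt0 //.
move: IH; set M := m.+1%:R : R; set F := ln _`!%:R.
have M1 : 1 <= M by rewrite ler1n.
have -> : m.+2%:R = M + 1 by rewrite /M -natr1.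
have E : ln (M + 1) = ln M + ln (1 + M^-1).
  by rewrite -lnM ?posrE ?addr_gt0 ?invr_gt0 //; congr ln; field; lra.
have := @ln1D_mul_le R M^-1; rewrite invr_gt0 invf_le1; last lra.
move=> /(_ _ M1) H; have {}H := H ltac:(lra).
rewrite E; move: H; set d := ln (1 + _); set l := ln M => H.
(* From [M] to [M + 1] the right side grows by [l + d] and the left side by
   [l + d + d (M + 1/8) - 1], so this is exactly the induction step. *)
have {}H : d * (M + 1 / 8%:R) <= 1.
  have -> : d * (M + 1 / 8%:R) = M * (d * (1 + M^-1 / 8%:R)) by field; lra.
  by rewrite -[leRHS](@mulfV _ M) ?ler_pM2l //; lra.
nra.
Qed.

(** * Comparing programs with permutations *)

(** A shortest program of length [l <= k] exhibits [f] as a product of [l] permutation instructions,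
    padded to [k] factors. *)
Lemma card_low_complexity (A : finType) (n k : nat) :
  (#|[set f : {perm {ffun 'I_n.+1 -> A}} | procedural_complexity f <= k]%SET|
   <= (n.+1 * #|A| `! ^ (#|A| ^ n)) ^ k)%N.
Proof.
have NI := card_perm_instructions A n.
apply: (@leq_trans (#|perm_instructions A n.+1| ^ k)%N); last first.
  by case: k => // k; rewrite leq_exp2r.
apply: leq_trans (card_expsg _ _); apply/subset_leq_card/fintype.subsetP => f.
rewrite inE /procedural_complexity; case: ex_minnP => l /existsP[gs /run_perm_expsg].
rewrite size_tuple => fl _ lk.
exact: (fintype.subsetP (subset_expsg _ _ _ (instruction1 A n.+1) lk)).
Qed.

(** With [m = q^(n+1)] and [t = ln m], the numerator is at most [expR (m (t - 1))] and [m!] is at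
    least [expR (m (t - 1) + t/8)]. The ratio is thus at most [expR (- t/8) <= 8/t]. *)
Lemma program_count_ratio (R : realType) (q n k : nat) : (2 <= q)%N ->
  k%:R <= (n.+1%:R * ln (q%:R : R) - 1) /
          (q%:R^-1 * ln ((q `!)%:R : R) + q%:R ^- n.+1 * ln (n.+1%:R : R)) ->
  ((n.+1 * q `! ^ (q ^ n)) ^ k)%:R / ((q ^ n.+1) `!)%:R
    <= 8%:R / ln (q%:R : R) / n.+1%:R.
Proof.
move=> q2; set D := q%:R^-1 * _ + _ => kD.
have q1 : 1 < (q%:R : R) by rewrite ltr1n.
have q0 : 0 < (q%:R : R) by lra.
have lnq : 0 < ln (q%:R : R) by rewrite ln_gt0.
have n0 : 0 < (n.+1%:R : R) by rewrite ltr0n.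
have D0 : 0 < D.
  rewrite /D ltr_wpDr //; first by rewrite mulr_ge0 ?ln_ge0 ?invr_ge0 ?exprn_ge0 ?ler1n // ltW.
  rewrite mulr_gt0 ?invr_gt0 // ln_gt0 // ltr1n.
  by apply: leq_trans q2 _; exact: fact_geq.
set N := (n.+1 * _)%N; set m := (q ^ n.+1)%N.
have N0 : 0 < (N%:R : R) by rewrite ltr0n muln_gt0 expn_gt0 fact_gt0.
have m0 : (0 < m)%N by rewrite expn_gt0 (ltn_trans _ q2).
have lnm : ln (m%:R : R) = n.+1%:R * ln (q%:R : R).
  by rewrite natrX lnXn // mulr_natl.
have lnN : ln (N%:R : R) = m%:R * D.
  rewrite natrM lnM ?posrE // ?natrX ?exprn_gt0 ?ltr0n ?fact_gt0 //.
  rewrite lnXn ?ltr0n ?fact_gt0 // -[ln _ *+ _]mulr_natl !natrX /D mulrDr addrC.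
  congr (_ + _); last by rewrite mulrA mulfV ?mul1r // expf_neq0 // gt_eqF.
  by rewrite mulrA exprSr mulfK // gt_eqF.
have := @ln_fact_ge R m m0; rewrite lnm => lnfact.
have {kD}kN : k%:R * ln (N%:R : R) <= m%:R * (n.+1%:R * ln q%:R - 1).
  rewrite lnN mulrCA ler_wpM2l // -ler_pdivlMr //.
rewrite natrX; set F := (m `!)%:R.
have F0 : 0 < (F : R) by rewrite ltr0n fact_gt0.
rewrite -[leLHS]lnK ?posrE ?divr_gt0 ?exprn_gt0 //.
rewrite ln_div ?posrE ?exprn_gt0 // lnXn // -[ln _ *+ _]mulr_natl.
pose t : R := n.+1%:R * ln q%:R.
have t0 : 0 < t by rewrite mulr_gt0.
apply: (@le_trans _ _ (expR (- (t / 8%:R)))).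
  by rewrite ler_expR; move: kN lnfact; rewrite -/t -/F; lra.
have -> : 8%:R / ln q%:R / n.+1%:R = (t / 8%:R)^-1 by rewrite /t; field; rewrite ?lt0r_neq0.
rewrite expRN lef_pV2 ?posrE ?expR_gt0 //; last lra.
by apply: le_trans (expR_ge1Dx _); lra.
Qed.

Theorem proposition3 (R : realType) (q : nat) (hq : (2 <= q)%N)
    (A : finType) (hA : #|A| = q) :
  (fun n : nat =>
     #|[set f : {perm {ffun 'I_n -> A}} |
         Num.floor ((n%:R * ln (q%:R : R) - 1) /
                    (q%:R^-1 * ln ((q`!)%:R : R) + q%:R ^- n * ln (n%:R : R)))
           + 1 <= (procedural_complexity f)%:Z]%SET|%:R
     / #|{perm {ffun 'I_n -> A}}|%:R : R) @ \oo --> (1 : R).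
Proof.
have card_perms n : #|{perm {ffun 'I_n -> A}}| = ((q ^ n) `!)%N.
  have -> : (q ^ n)%N = #|[set: {ffun 'I_n -> A}]%SET|.
    by rewrite cardsT card_ffun card_ord hA.
  rewrite -card_perm; apply: eq_card => s; rewrite !inE; symmetry.
  by apply/fintype.subsetP => x _; rewrite inE.
(* The counts above are in dimension [n.+1]; shifting the index keeps the limit. *)
rewrite -cvg_shiftS /=.
apply: (@squeeze_cvgr _ _ _ _ (fun n => 1 - 8%:R / ln q%:R * harmonic n) (cst 1)).
- near=> n; rewrite card_perms.
  set S := [set f | _]%SET; set B := (_ / (q%:R^-1 * _ + _)) in S *.
  have F0 : 0 < (((q ^ n.+1) `!)%:R : R) by rewrite ltr0n fact_gt0.
  have SF : (#|S| + #|~: S|%SET = (q ^ n.+1) `!)%N by rewrite cardsC card_perms.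
  rewrite /= ler_pdivrMr // mul1r ler_nat -{2}SF leq_addr andbT.
  (* Pass to the complement, whose members have complexity at most the floor of [B]. *)
  have -> : (#|S|%:R : R) / ((q ^ n.+1) `!)%:R =
            1 - #|~: S|%SET%:R / ((q ^ n.+1) `!)%:R.
    by rewrite -[in LHS](addnK #|~: S|%SET #|S|) SF natrB -?SF ?leq_addl //
       mulrBl mulfV // SF gt_eqF.
  rewrite lerD2l lerN2 /harmonic /=.
  have SC f : f \in (~: S)%SET -> (procedural_complexity f)%:Z <= Num.floor B.
    by rewrite !inE -ltNge ltzD1.
  (* If the floor is negative, the complement is empty, since complexities are natural numbers. *)
  case E : (Num.floor B) => [k|k]; last first.
    suff -> : (~: S)%SET = finset.set0 by
      rewrite cards0 mul0r !mulr_ge0 ?invr_ge0 ?ln_ge0 ?ler1n // ltnW.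
    by apply/finset.setP => f; rewrite [RHS]inE; apply/negP => /SC; rewrite E.
  apply: le_trans (@program_count_ratio R q n k hq _); last first.
    by rewrite -/B -[k%:R]/((Posz k)%:~R) -E floor_le.
  rewrite ler_pM2r ?invr_gt0 // ler_nat -[in leqRHS]hA.
  apply: leq_trans (card_low_complexity A n k); apply/subset_leq_card/fintype.subsetP => f.
  by move=> /SC; rewrite E inE.
- rewrite -[X in _ --> X]subr0 -[X in _ --> _ - X](mulr0 (8%:R / ln q%:R)).
  by apply: cvgB; [exact: cvg_cst|apply: cvgMr; exact: cvg_harmonic].
- exact: cvg_cst.
Unshelve. all: by end_near.
Qed.
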